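(* For every even rational parameter $A=p/q\in(0,1)$ one has $$\Phi_\Gamma(\zeta_\Gamma)=\Psi\circ\Phi_\Pi(\zeta_\Pi)\qquad\text{for all }\zeta_\Gamma\in G_\Gamma,$$ where $G_\Gamma$ is the graph grid, $\zeta_\Pi$ is the center of the unit integer square containing $\zeta_\Gamma$, $\Phi_\Gamma$ and $\Phi_\Pi$ are the graph and plaid classifying maps, and $\Psi$ is the projective intertwiner.
   Context: An even rational parameter is $A=p/q\in(0,1)$ in lowest terms with $pq$ even. Put $P=\frac{2A}{1+A}$. **Graph grid.** $G_\Gamma=\Bigl\{\bigl(\tfrac{1+A}{2},\tfrac{1-A}{2}\bigr)+m\bigl(A,\tfrac{1+2A-A^2}{1+A}\bigr)+n\bigl(1,-\tfrac{2A}{1+A}\bigr): m,n\in\mathbb{Z}\Bigr\}$. No point of $G_\Gamma$ lies on the boundary of a unit integer square (unit square with integer vertices), so each $\zeta_\Gamma\in G_\Gamma$ lies in the interior of a unique such square. $G_\Pi=(\mathbb{Z}+\frac12)^2$ is the set of centers of unit integer squares. **Spaces.** Let $\widehat X=\mathbb{R}^3\times[0,1]$. The plaid lattice acts on the slice $\mathbb{R}^3\times\{P\}$ by the translations generated by $(2,P,P)$, $(0,2,0)$, $(0,0,2)$ in the first three coordinates; $X_\Pi=[-1,1]^3\times[0,1]$ is a fundamental domain. The graph lattice $\Lambda$ acts on the slice $\mathbb{R}^3\times\{A\}$ by the translations generated by $(1,-1,-1)$, $(0,1+A,1-A)$, $(0,0,1+A)$; $X_\Gamma=\widehat X/\Lambda$,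 and $[\cdot]_\Lambda$ denotes the class in $X_\Gamma$. **Classifying maps.** For $(x,y)\in G_\Pi$, $\Phi_\Pi(x,y)=(2Px+2y,\,2Px,\,2Px+2Py,\,P)$, translated by the plaid lattice into a representative in $X_\Pi$. For $(x,y)\in G_\Gamma$, $\Phi_\Gamma(x,y)=[(x,x,x,A)]_\Lambda$. **Projective intertwiner.** Let $X_{\Pi,+}$ be the set of $(x,y,z,P)\in X_\Pi$ with $x\le y$ and $X_{\Pi,-}$ the set with $y\le x$. For $(x,y,z,P)\in X_{\Pi,\pm}$, $$\Psi(x,y,z,P)=\Bigl[\tfrac{1}{2-P}\bigl(x-y,\,-y-1,\,z+P+1,\,P\bigr)\pm(1,0,0,0)\Bigr]_\Lambda .$$ (The fourth coordinate is $P/(2-P)=A$. On points of the form $\Phi_\Pi(\zeta_\Pi)$ with $\zeta_\Pi\in G_\Pi$, the value does not depend on the choice of representative in $X_\Pi$, and the case $x=y$ does not occur.) *)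

(* Defs.v *)
From HB Require Import structures.
From mathcomp Require Import all_boot all_order all_algebra.
From mathcomp Require Import generic_quotient.
From mathcomp Require Import boolp classical_sets reals.
From mathcomp Require Import ring lra.
Set Implicit Arguments.
Unset Strict Implicit.
Unset Printing Implicit Defensive.
Import Order.TTheory GRing.Theory Num.Theory.
Local Open Scope classical_set_scope.
Local Open Scope ring_scope.

Definition unit_interval (R : realType) := {t : R | 0 <= t <= 1}.

Definition even_rational (R : realType) (A : unit_interval R) : Prop :=
  exists p q : nat,
    [/\ (0 < p)%N, (p < q)%N, coprime p q, ~~ odd (p * q)
      & val A = p%:R / q%:R].

Lemma plaid_param_subproof (R : realType) (A : unit_interval R) :
  0 <= 2 * val A / (1 + val A) <= 1.
Proof.
case: A => a /= /andP[a0 a1]; have h : 0 < 1 + a by lra.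
by rewrite divr_ge0 ?ler_pdivrMr //=; lra.
Qed.

(* P = 2A / (1 + A) *)
Definition plaid_param (R : realType) (A : unit_interval R) : unit_interval R :=
  exist _ (2 * val A / (1 + val A)) (plaid_param_subproof A).

Lemma graph_param_subproof (R : realType) (P : unit_interval R) :
  0 <= val P / (2 - val P) <= 1.
Proof.
case: P => t /= /andP[t0 t1]; have h : 0 < 2 - t by lra.
by rewrite divr_ge0 ?ler_pdivrMr //=; lra.
Qed.

(* P / (2 - P), the inverse of A |-> 2A / (1 + A) *)
Definition graph_param (R : realType) (P : unit_interval R) : unit_interval R :=
  exist _ (val P / (2 - val P)) (graph_param_subproof P).

Section Grids.
Variable R : realType.

Definition graph_grid (A : unit_interval R) : set (R * R) :=
  [set u | exists m n : int, let a := val A in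
    u = ((1 + a) / 2 + m%:~R * a + n%:~R,
         (1 - a) / 2 + m%:~R * ((1 + 2 * a - a ^+ 2) / (1 + a))
                     - n%:~R * (2 * a / (1 + a)))].

(* Closed; no point of the graph grid lies on the boundary of such a square. *)
Definition unit_square (i j : int) : set (R * R) :=
  [set u | i%:~R <= u.1 <= i%:~R + 1 /\ j%:~R <= u.2 <= j%:~R + 1].

Definition square_center (i j : int) : R * R := (i%:~R + 2^-1, j%:~R + 2^-1).

Definition plaid_grid : set (R * R) :=
  [set u | exists i j : int, u = square_center i j].

End Grids.

Section Spaces.
Variable R : realType.

Definition Xhat : Type := (R * R * R * unit_interval R)%type.

(* translation by a(2,P,P) + b(0,2,0) + c(0,0,2) in the slice of height P *)
Definition plaid_translate (a b c : int) (v : Xhat) : Xhat :=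
  let: (x, y, z, P) := v in
  (x + a%:~R * 2,
   y + a%:~R * val P + b%:~R * 2,
   z + a%:~R * val P + c%:~R * 2, P).

(* translation by a(1,-1,-1) + b(0,1+A,1-A) + c(0,0,1+A) in the slice of
   height A *)
Definition graph_translate (a b c : int) (v : Xhat) : Xhat :=
  let: (x, y, z, A) := v in
  (x + a%:~R,
   y - a%:~R + b%:~R * (1 + val A),
   z - a%:~R + b%:~R * (1 - val A) + c%:~R * (1 + val A), A).

Definition X_Pi : set Xhat :=
  [set v | let: (x, y, z, _) := v in
    [/\ -1 <= x <= 1, -1 <= y <= 1 & -1 <= z <= 1]].

Definition graph_rel (v w : Xhat) : bool :=
  `[< exists a b c : int, w = graph_translate a b c v >].

Lemma graph_rel_refl : reflexive graph_rel.
Proof.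
move=> [[[x y] z] t]; apply/asboolP; exists 0, 0, 0 => /=.
by congr (_, _, _, _); ring.
Qed.

Lemma graph_rel_sym : symmetric graph_rel.
Proof.
suff imp v w : graph_rel v w -> graph_rel w v.
  by move=> v w; apply/idP/idP; exact: imp.
case: v => [[[x y] z] t] /asboolP[a [b [c ->]]].
apply/asboolP; exists (- a), (- b), (- c) => /=.
by rewrite !mulrNz; congr (_, _, _, _); ring.
Qed.

Lemma graph_rel_trans : transitive graph_rel.
Proof.
move=> w [[[x y] z] t] u /asboolP[a [b [c ->]]] /asboolP[a' [b' [c' ->]]].
apply/asboolP; exists (a + a'), (b + b'), (c + c') => /=.
by rewrite !intrD; congr (_, _, _, _); ring.
Qed.

Canonical graph_equiv :=
  EquivRel graph_rel graph_rel_refl graph_rel_sym graph_rel_trans.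

Definition X_Gamma := {eq_quot graph_equiv}%qT.

Definition graph_class (v : Xhat) : X_Gamma := (\pi v)%qT.

Lemma graph_classP (v w : Xhat) :
  graph_class v = graph_class w <->
  exists a b c : int, w = graph_translate a b c v.
Proof. by split=> [/eqmodP/asboolP //|H]; apply/eqmodP/asboolP. Qed.

End Spaces.

Section ClassifyingMaps.
Variable R : realType.

Definition plaid_lift (A : unit_interval R) (u : R * R) : Xhat R :=
  let P := val (plaid_param A) in
  (2 * P * u.1 + 2 * u.2, 2 * P * u.1, 2 * P * u.1 + 2 * P * u.2,
   plaid_param A).

(* The representative in X_Pi need not be unique (it can lie on the boundary),
   so Phi is only required to pick some representative at each point. *)
Definition plaid_classifying_map (A : unit_interval R)
    (Phi : R * R -> Xhat R) : Prop :=
  forall u, plaid_grid u ->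
    X_Pi (Phi u) /\
    exists a b c : int, Phi u = plaid_translate a b c (plaid_lift A u).

Lemma exists_plaid_classifying_map (A : unit_interval R) :
  exists Phi, plaid_classifying_map A Phi.
Proof.
have red (x : R) : exists n : int, -1 <= x + n%:~R * 2 <= 1.
  exists (- Num.floor ((x + 1) / 2)); rewrite mulrNz.
  have := floor_le ((x + 1) / 2); have := floorD1_gt ((x + 1) / 2).
  by rewrite intrD; lra.
suff /choice[Phi PhiP] : forall u, exists v, X_Pi v /\
    exists a b c : int, v = plaid_translate a b c (plaid_lift A u).
  by exists Phi => u _.
move=> u; set P := val (plaid_param A).
have [a ha] := red (2 * P * u.1 + 2 * u.2).
have [b hb] := red (2 * P * u.1 + a%:~R * P).
have [c hc] := red (2 * P * u.1 + 2 * P * u.2 + a%:~R * P).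
by exists (plaid_translate a b c (plaid_lift A u)); split; [split|exists a, b, c].
Qed.

Definition Phi_Gamma (A : unit_interval R) (u : R * R) : X_Gamma R :=
  graph_class (u.1, u.1, u.1, A).

(* The sign is + on X_{Pi,+} (x <= y) and - on X_{Pi,-} (y <= x).  The tie
   x = y, resolved here as +, never occurs for images of plaid grid points. *)
Definition Psi (v : Xhat R) : X_Gamma R :=
  let: (x, y, z, P) := v in
  let k := (2 - val P)^-1 in
  graph_class (k * (x - y) + (if x <= y then 1 else -1),
               k * (- y - 1), k * (z + val P + 1), graph_param P).

End ClassifyingMaps.

(* Main.v *)
(** Put [k = (1 + A) / 2], so that [k (2 - P) = 1].  Write the grid point as the
    center [(i + 1/2, j + 1/2)] plus [(xi, eta)], with grid coordinates [(m, n)],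
    let [(x, y, z)] be its plaid image, obtained by the plaid translation
    [(a, b, c)], and set [u = k (x - y)], [v = u - x / 2].  With the integers
    [M = j - b - m] and [N = n - i - m - a] one finds
      [u = xi + 1/2 - N + (1 + A) M],  [v = eta + P xi + (1 + A) M],
    so [(u, v)] lies in the parallelogram [|u - v| <= 1/2], [|v - P u / 2| <= 1/2]
    and also in a lattice translate of a second parallelogram.  These meet only
    when [M = 0] and [N] is [0] or [1]; then [N = 1] exactly when [x <= y], and
    the two points of [X_Gamma] differ by an explicit element of the graph
    lattice.  Parity of [p] and [q] is used only to get [|xi| < 1/2]. *)

Require Import Defs.
From mathcomp Require Import all_boot all_order all_algebra.
From mathcomp Require Import boolp classical_sets reals.
From mathcomp Require Import zify ring lra.

Set Implicit Arguments.
Unset Strict Implicit.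
Unset Printing Implicit Defensive.
Import Order.TTheory GRing.Theory Num.Theory.
Local Open Scope ring_scope.

Lemma even_rational_mul_odd (R : realType) (A : unit_interval R) (m l : int) :
  even_rational A -> val A * (2 * m%:~R + 1) != 2 * l%:~R + 1.
Proof.
move=> [p [q [p0 ltpq cop pq ->]]]; apply/eqP => E.
have q0 : q%:R != 0 :> R by rewrite pnatr_eq0; lia.
have {}E : p%:Z * (2 * m + 1) = q%:Z * (2 * l + 1).
  apply: (@intr_inj R); rewrite !intrM !intrD !intrM -!pmulrn.
  transitivity (q%:R * (p%:R / q%:R * (2 * m%:~R + 1)) : R); first by field.
  by rewrite E.
have par : odd p = odd q.
  move: E; rewrite !mulrDr !mulr1 !(mulrCA _ 2).
  by move: (p%:Z * m) (q%:Z * l) => s t; lia.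
move: pq; rewrite oddM -par andbb => evp.
have d2 : (2 %| gcdn p q)%N by rewrite dvdn_gcd !dvdn2 -par evp.
by move: d2; rewrite (eqP cop).
Qed.

Lemma even_rational_gt0 (R : realType) (A : unit_interval R) :
  even_rational A -> 0 < val A < 1.
Proof.
move=> [p [q [p0 ltpq _ _ ->]]].
have q0 : (0 < q)%N by lia.
by rewrite divr_gt0 ?ltr0n// ltr_pdivrMr ?ltr0n// mul1r ltr_nat.
Qed.

Section Parallelograms.
Variables (R : realFieldType) (A P : R).
Hypotheses (A01 : 0 < A < 1) (PE : P * (1 + A) = 2 * A).

Lemma parallelogram_overlap_le (u v : R) (M N : int) :
  -1 <= 2 * (u - v) <= 1 -> -1 <= P * u - 2 * v <= 1 ->
  0 < u + N%:~R - (1 + A) * M%:~R < 1 ->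
  -1 <= 2 * (v - (1 + A) * M%:~R
             - P * (u + N%:~R - 2^-1 - (1 + A) * M%:~R)) <= 1 ->
  M <= 0 /\ (M = 0 -> N <= 1).
Proof.
move=> /andP[x0 x1] /andP[y0 y1] /andP[f0 f1] /andP[e0 _].
case/andP: A01 => A0 A1.
have PAE : P + P * A = 2 * A by rewrite -PE; ring.
have k0 : 0 < 1 + A by lra.
have P1 : P < 1 by rewrite -(ltr_pM2r k0) PE; lra.
have AP : A < P by rewrite -(ltr_pM2r k0) PE; nra.
have P0 : 0 < P by lra.
set th := u + N%:~R - (1 + A) * M%:~R in f0 f1.
have {}e0 : -1 <= 2 * (v - (1 + A) * M%:~R - P * (th - 2^-1)).
  by rewrite /th; lra.
have Pth : 0 < P * th by rewrite mulr_gt0.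
have Qth : 0 < (1 - P) * (1 - th) by rewrite mulr_gt0 ?subr_gt0.
have thE : u = th - N%:~R + (1 + A) * M%:~R by rewrite /th; ring.
clearbody th; split; last first.
  move=> M0; rewrite leNgt; apply/negP => N2.
  have {N2} N2 : 2 <= N%:~R :> R by rewrite (ler_int _ 2).
  rewrite {}M0 in thE e0; lra.
have PuE : P * u * (1 + A) = 2 * A * u by rewrite mulrAC PE.
rewrite leNgt; apply/negP => M1.
have [M2|M2] := leP 2 M.
  have {M2} M2 : 0 <= (1 + A) * (M%:~R - 2).
    by rewrite mulr_ge0 ?subr_ge0 ?(ler_int _ 2)// ltW.
  have w0 : 0 <= A * (1 - 2 * (u - v)) by rewrite mulr_ge0 ?subr_ge0// ltW.
  have w1 : 0 <= (1 + A) * (1 + P * u - 2 * v) by rewrite mulr_ge0; lra.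
  lra.
have {M1 M2} ME : M = 1 by clear -M1 M2; lia.
rewrite {}ME mulr1 in thE e0.
have ub : 0 <= (1 + A) * (2 - 2 * u + P * u) by rewrite mulr_ge0; lra.
have [N0|N0] := leP N 0.
  have {N0} N0 : N%:~R <= 0 :> R by rewrite (ler_int _ _ 0).
  lra.
have [N2|N2] := leP 2 N.
  have {N2} N2 : 2 <= N%:~R :> R by rewrite (ler_int _ 2).
  lra.
have NE : N = 1 by clear -N0 N2; lia.
rewrite {}NE in thE.
have PthE : P * u = P * th + P * A by rewrite thE; ring.
lra.
Qed.

Lemma parallelogram_overlap (u v : R) (M N : int) :
  -1 <= 2 * (u - v) <= 1 -> -1 <= P * u - 2 * v <= 1 ->
  0 < u + N%:~R - (1 + A) * M%:~R < 1 ->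
  -1 <= 2 * (v - (1 + A) * M%:~R
             - P * (u + N%:~R - 2^-1 - (1 + A) * M%:~R)) <= 1 ->
  M = 0 /\ (N = 0 \/ N = 1).
Proof.
move=> hx hy hf he.
have [M0 N1] := parallelogram_overlap_le hx hy hf he.
(* The configuration is symmetric under [(u, v, M, N) -> (-u, -v, -M, 1 - N)]. *)
have [] := @parallelogram_overlap_le (- u) (- v) (- M) (1 - N);
  rewrite ?intrD ?mulrNz; try lra.
by clear -M0 N1; lia.
Qed.

End Parallelograms.

Theorem theorem9p2 (R : realType) (A : unit_interval R) (hA : even_rational A)
    (Phi_Pi : R * R -> Xhat R) (hPhi_Pi : plaid_classifying_map A Phi_Pi)
    (zeta_Gamma : R * R) (hzeta : graph_grid A zeta_Gamma)
    (i j : int) (hij : unit_square i j zeta_Gamma) :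
  Phi_Gamma A zeta_Gamma = Psi (Phi_Pi (square_center R i j)).
Proof.
have [] := hPhi_Pi (square_center R i j); first by exists i, j.
move=> XPhi [a [b [c PhiE]]]; move: XPhi; rewrite PhiE {PhiE} /plaid_lift /=.
have A01 := even_rational_gt0 hA.
set t := val A in A01 *; set P := 2 * t / (1 + t).
have t1 : 1 + t != 0 by lra.
have PE : P * (1 + t) = 2 * t by rewrite /P; field.
have kE : (2 - P)^-1 = (1 + t) / 2 by rewrite /P; field; rewrite t1; lra.
have gA : graph_param (plaid_param A) = A.
  by apply: val_inj; rewrite /= -/t -/P kE /P; field.
case: hzeta hij => m [n]; rewrite /= -/t => -> /= [hX hY] {zeta_Gamma}.
set X := (1 + t) / 2 + _ + _ in hX *.
have YE : (1 - t) / 2 + m%:~R * ((1 + 2 * t - t ^+ 2) / (1 + t)) - n%:~R * P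
        = (1 + t) * (m%:~R + 2^-1) - P * X.
  by rewrite /X /P; field.
rewrite YE {YE} /= in hY.
have Xi : X != i%:~R.
  apply/eqP => XE; have /eqP := even_rational_mul_odd m (i - n - 1) hA; apply.
  by rewrite -/t !intrB -XE /X; field.
have Xi1 : X != i%:~R + 1.
  apply/eqP => XE; have /eqP := even_rational_mul_odd m (i - n) hA; apply.
  rewrite -/t intrB (_ : i%:~R = X - 1 :> R); last by rewrite XE; ring.
  by rewrite /X; field.
have {Xi Xi1} hX : i%:~R < X < i%:~R + 1.
  by move: hX; rewrite !lt_neqAle Xi1 eq_sym Xi.
move=> [hx hy _].
set x := _ + a%:~R * 2 in hx *; set y := _ + b%:~R * 2 in hy *.
pose M := j - b - m; pose N := n - i - m - a.
pose u := (1 + t) / 2 * (x - y); pose v := u - x / 2.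
have uE : u = X - i%:~R - N%:~R + (1 + t) * M%:~R.
  by rewrite /u /x /y /N /M /X /P !intrB; field.
have hyE : P * u - 2 * v = y by rewrite /v /u /P; field.
have vE : v - (1 + t) * M%:~R - P * (u + N%:~R - 2^-1 - (1 + t) * M%:~R) =
    (1 + t) * (m%:~R + 2^-1) - P * X - j%:~R - 2^-1.
  by rewrite /v uE /x /N /M /X /P !intrB; field.
have [] := @parallelogram_overlap R t P A01 PE u v M N.
- by rewrite /v; lra.
- by rewrite hyE.
- by rewrite uE; lra.
- by rewrite vE; lra.
move=> M0 N01.
have sE : (if x <= y then 1 else -1) = 2 * N%:~R - 1 :> R.
  have xy : (x <= y) = (u <= 0) by rewrite /u pmulr_rle0 ?subr_le0//; lra.
  rewrite xy uE M0; case: N01 => ->; case: ifP; lra.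
rewrite gA kE sE.
apply/graph_classP.
exists (N - i - 1), (- (2 * i + j + 2 + a)), (j + 1 + c - m) => /=.
have mE : m = j - b by clear -M0; rewrite /M in M0; lia.
rewrite -/t /x /y /X /N mE !(intrD, mulrNz, intrM) /P.
by congr (_, _, _, _); field.
Qed.
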